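(* Let $\mathscr{A}\in\mathbb{C}^{n\times n\times p}$. If $[\rho_T(\mathscr{A})]\prec[e_1]$, then $\mathscr{I}_{nnp}-\mathscr{A}$ is non-singular and $$(\mathscr{I}_{nnp}-\mathscr{A})^{-1}=\sum_{k=0}^{\infty}\mathscr{A}^k,$$ where $\mathscr{A}^k=\mathscr{A}*\cdots*\mathscr{A}$ ($k$ times) and $\mathscr{A}^0=\mathscr{I}_{nnp}$.
   Context: For a tensor $\mathscr{X}\in\mathbb{C}^{n\times m\times p}$, $X_k\in\mathbb{C}^{n\times m}$ denotes the $k$-th frontal slice. $\mathrm{Unfold}(\mathscr{X})\in\mathbb{C}^{np\times m}$ stacks $X_1,\dots,X_p$ vertically, and $\mathrm{Fold}$ is its inverse. $\mathrm{bcirc}(\mathscr{X})\in\mathbb{C}^{np\times mp}$ is the block-circulant matrix whose $(i,j)$ block is $X_{((i-j)\bmod p)+1}$. The T-product of $\mathscr{X}\in\mathbb{C}^{n\times m\times p}$ and $\mathscr{Y}\in\mathbb{C}^{m\times\ell\times p}$ is $\mathscr{X}*\mathscr{Y}=\mathrm{Fold}(\mathrm{bcirc}(\mathscr{X})\,\mathrm{Unfold}(\mathscr{Y}))$. $\mathscr{I}_{nnp}$ is the $n\times n\times p$ tensor whose first frontal slice is $I_n$ and whose other slices are zero; $\mathscr{A}$ is non-singular if some $\mathscr{B}$ satisfies $\mathscr{A}*\mathscr{B}=\mathscr{B}*\mathscr{A}=\mathscr{I}_{nnp}$, and then $\mathscr{A}^{-1}=\mathscr{B}$. The conjugate transpose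 $\mathscr{X}^H$ is the tensor with $\mathrm{bcirc}(\mathscr{X}^H)=\mathrm{bcirc}(\mathscr{X})^H$; $\mathscr{A}$ is Hermitian if $\mathscr{A}^H=\mathscr{A}$. A tubular tensor of length $p$ is a $1\times1\times p$ tensor; $[v]$ is the one with $[v]_{11j}=v_j$ ($v\in\mathbb{C}^p$), and $\mathrm{circ}([v])$ is the circulant matrix with $(i,j)$ entry $v_{((i-j)\bmod p)+1}$. $e_1=(1,0,\dots,0)^T\in\mathbb{C}^p$, so $[e_1]$ is the identity tubular tensor. $F_p$ is the unitary DFT matrix with entries $p^{-1/2}\omega^{(j-1)(k-1)}$, $\omega=e^{-2\pi\mathbf{i}/p}$. Order: $\mathscr{A}\in\mathbb{C}^{n\times n\times p}$ is positive (semi)definite if the first frontal slice of $\mathscr{X}^H*\mathscr{A}*\mathscr{X}$ (a scalar) is $>0$ ($\ge0$) for all nonzero $\mathscr{X}\in\mathbb{C}^{n\times1\times p}$. For Hermitian $\mathscr{A},\mathscr{B}$, $\mathscr{A}\succ\mathscr{B}$ ($\mathscr{A}\succeq\mathscr{B}$) means $\mathscr{A}-\mathscr{B}$ is positive definite (semidefinite); $\prec,\preceq$ are analogous. This applies in particular to tubular tensors ($n=1$). For a Hermitian positive semidefinite tubular tensor $[v]$ with $\mathrm{circ}([v])=F_p\,\mathrm{diag}(d_1,\dots,d_p)F_p^H$, $[v]^{1/2}$ is the tubular tensor with $\mathrm{circ}([v]^{1/2})=F_p\,\mathrm{diag}(\sqrt{d_1},\dots,\sqrt{d_p})F_p^H$.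 Tubular eigenvalue: $[\lambda]$ is a tubular eigenvalue of $\mathscr{A}$ if there is $\mathscr{X}\in\mathbb{C}^{n\times1\times p}$ with $\mathscr{A}*\mathscr{X}=\mathscr{X}*[\lambda]$ and $\mathscr{X}^H*\mathscr{X}$ non-singular; $\sigma_T(\mathscr{A})$ is the set of tubular eigenvalues. Tubular spectral radius: $[\rho_T(\mathscr{A})]=([\mu]^H*[\mu])^{1/2}$, where $[\mu]\in\sigma_T(\mathscr{A})$ satisfies $[\mu]^H*[\mu]\succeq[\lambda]^H*[\lambda]$ for all $[\lambda]\in\sigma_T(\mathscr{A})$ (such $[\mu]$ exists, and the value does not depend on its choice). *)

(* Defs.v *)
From HB Require Import structures.
From mathcomp Require Import all_boot all_order all_algebra complex.
From mathcomp Require Import all_classical all_reals all_analysis.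
From mathcomp Require Import ring lra.

Set Implicit Arguments.
Unset Strict Implicit.
Unset Printing Implicit Defensive.

Import Order.TTheory GRing.Theory Num.Theory numFieldNormedType.Exports.
Local Open Scope classical_set_scope.
Local Open Scope ring_scope.
Local Open Scope sesquilinear_scope.

(* [X k] is the k-th frontal slice; slices are numbered from 0. *)
Notation tensor T n m p := {ffun 'I_p -> 'M[T]_(n, m)}.

(* The tube length is written p.+1, so that it is positive and the subtraction
   [i - j] (or opposite [- k]) of indices in 'I_p.+1 is the one modulo p.+1. *)

Section TProduct.
Variables (T : pzRingType) (p : nat).

Definition bcirc n m (X : tensor T n m p.+1) :
    'M[T]_(\sum_(i < p.+1) n, \sum_(j < p.+1) m) :=
  \mxblock_(i < p.+1, j < p.+1) X (i - j).

Definition tunfold n m (X : tensor T n m p.+1) : 'M[T]_(\sum_(i < p.+1) n, m) :=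
  \mxcol_(i < p.+1) X i.

Definition tfold n m (M : 'M[T]_(\sum_(i < p.+1) n, m)) : tensor T n m p.+1 :=
  [ffun i => submxcol M i].

Definition tprod n m l (X : tensor T n m p.+1) (Y : tensor T m l p.+1) :
    tensor T n l p.+1 :=
  tfold (bcirc X *m tunfold Y).

Definition tid n : tensor T n n p.+1 :=
  [ffun k => if k == 0 then 1%:M else 0].

Definition tpow n (A : tensor T n n p.+1) (k : nat) : tensor T n n p.+1 :=
  iter k (tprod A) (tid n).

Definition is_tinverse n (A B : tensor T n n p.+1) : Prop :=
  tprod A B = tid n /\ tprod B A = tid n.

Definition tnonsingular n (A : tensor T n n p.+1) : Prop :=
  exists B, is_tinverse A B.

Definition tinv n (A : tensor T n n p.+1) : tensor T n n p.+1 :=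
  xget 0 [set B | is_tinverse A B].

Definition tube (v : 'cV[T]_p.+1) : tensor T 1 1 p.+1 :=
  [ffun k => const_mx (v k 0)].

Definition circ (v : tensor T 1 1 p.+1) : 'M[T]_p.+1 :=
  \matrix_(i, j) v (i - j) 0 0.

End TProduct.

Arguments tid {T p n}.

Section HermitianOrder.
Variables (C : numClosedFieldType) (p : nat).

(* The slices of X^H are read off bcirc(X^H) = bcirc(X)^H, see [bcirc_tconj]. *)
Definition tconj n m (X : tensor C n m p.+1) : tensor C m n p.+1 :=
  [ffun k => (X (- k))^t*].

(* On a [numClosedFieldType], 0 <= z and 0 < z include that z is real. *)
Definition tpsd n (A : tensor C n n p.+1) : Prop :=
  forall X : tensor C n 1 p.+1, X != 0 ->
    0 <= tprod (tprod (tconj X) A) X 0 0 0.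

Definition tpd n (A : tensor C n n p.+1) : Prop :=
  forall X : tensor C n 1 p.+1, X != 0 ->
    0 < tprod (tprod (tconj X) A) X 0 0 0.

(* Meant for Hermitian arguments. *)
Definition tle n (A B : tensor C n n p.+1) : Prop := tpsd (B - A).
Definition tlt n (A B : tensor C n n p.+1) : Prop := tpd (B - A).

Definition tubular_eigenvalue n (A : tensor C n n p.+1) :
    set (tensor C 1 1 p.+1) :=
  [set l | exists X : tensor C n 1 p.+1,
     tprod A X = tprod X l /\ tnonsingular (tprod (tconj X) X)].

Lemma bcirc_tconj n m (X : tensor C n m p.+1) :
  bcirc (tconj X) = (bcirc X)^t*.
Proof.
rewrite /bcirc tr_mxblock; apply/matrixP => i j.
by rewrite !mxE ffunE !mxE opprB.
Qed.

End HermitianOrder.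

(* Entrywise convergence, i.e. convergence in the finite-dimensional space of
   tensors. *)
Definition tensor_cvg (K : numFieldType) n m p
    (u : nat -> tensor K n m p) (l : tensor K n m p) : Prop :=
  forall k i j, (fun N => u N k i j) @ \oo --> l k i j.

Section SpectralRadius.
Variables (R : realType) (p : nat).
Local Notation C := R[i].

(* exp (- 2 pi i / p) for the tube length p.+1 *)
Definition dft_root : C :=
  Complex (cos (2 * pi / p.+1%:R)) (- sin (2 * pi / p.+1%:R)).

Definition dft : 'M[C]_p.+1 :=
  \matrix_(j, k) ((sqrtC p.+1%:R)^-1 * dft_root ^+ (j * k)).

(* The eigenvalues d of circ v are the diagonal of F^H circ(v) F, and the
   square root is the first column of F diag(sqrt d) F^H, see [circ_tsqrt]. *)
Definition tsqrt (v : tensor C 1 1 p.+1) : tensor C 1 1 p.+1 :=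
  let D := dft^t* *m circ v *m dft in
  tube (col 0 (dft *m diag_mx (\row_j sqrtC (D j j)) *m dft^t*)).

Definition tubular_spectral_radius n (A : tensor C n n p.+1) :
    tensor C 1 1 p.+1 :=
  let mu := xget 0 [set mu | tubular_eigenvalue A mu /\
    forall l, tubular_eigenvalue A l ->
      tle (tprod (tconj l) l) (tprod (tconj mu) mu)] in
  tsqrt (tprod (tconj mu) mu).

Let dft_rootX k : dft_root ^+ k =
  Complex (cos (k%:R * (2 * pi / p.+1%:R))) (- sin (k%:R * (2 * pi / p.+1%:R))).
Proof.
elim: k => [|k IH]; first by rewrite !mul0r cos0 sin0 oppr0.
set x := 2 * pi / _ in IH *.
have -> : k.+1%:R * x = k%:R * x + x by rewrite -natr1 mulrDl mul1r.
rewrite exprSr IH /dft_root -/x cosD sinD.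
by apply/eqP; rewrite eq_complex /=; apply/andP; split; apply/eqP; ring.
Qed.

Lemma dft_root_prim : p.+1.-primitive_root dft_root.
Proof.
have p_neq0 : p.+1%:R != 0 :> R by rewrite pnatr_eq0.
apply/andP; split=> //; apply/forallP => -[k kp] /=.
rewrite unity_rootE dft_rootX -[_ == 1]/(_ == Complex 1 0) eq_complex /=.
set x := k.+1%:R * _.
have [kE|kNE] := eqVneq k.+1 p.+1.
  have -> : x = pi *+ 2.
    by rewrite /x kE mulrC divfK// mulr_natl.
  by rewrite cos2pi sin2pi oppr0 !eqxx.
have {kNE} kltp : (k.+1 < p.+1)%N by rewrite ltn_neqAle kNE.
apply/eqP/negbTE; apply/nandP; left.
pose y := x / 2.
have -> : x = y *+ 2 by rewrite /y -mulr_natr divfK.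
have sy : 0 < sin y.
  have yE : y = k.+1%:R / p.+1%:R * pi by rewrite /y /x; move: _^-1 => q; field.
  have pi0 := pi_gt0 R.
  apply: sin_gt0_pi; rewrite yE mulr_gt0 ?divr_gt0 ?ltr0n//=.
  by rewrite gtr_pMl// ltr_pdivrMr ?ltr0n// mul1r ltr_nat.
rewrite cos_mulr2n cos2sin2; apply/eqP => e.
have := exprn_gt0 2 sy; lra.
Qed.

Let dft_root_unit : dft_root \is a GRing.unit.
Proof.
by rewrite unitfE (prim_root_eq0 dft_root_prim).
Qed.

Let conj_dft_root : dft_root^* = dft_root^-1.
Proof.
apply: (mulrI dft_root_unit); rewrite divrr//.
apply/eqP; rewrite eq_complex /=; apply/andP; split; apply/eqP; last by ring.
by rewrite mulrN opprK mulrNN -!expr2 cos2Dsin2.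
Qed.

Let conj_dftE (j k : 'I_p.+1) :
  dft^t* j k = (sqrtC p.+1%:R)^-1 * (dft_root ^+ j)^-1 ^+ k.
Proof.
rewrite !mxE rmorphM rmorphXn /= conj_dft_root exprVn -exprM mulnC -exprVn.
by congr (_ * _); rewrite conj_Creal// realV realE sqrtC_ge0 ler0n.
Qed.

Let dft_normE : (sqrtC p.+1%:R)^-1 * (sqrtC p.+1%:R)^-1 = p.+1%:R^-1 :> C.
Proof. by rewrite -invfM -expr2 sqrtCK. Qed.

Lemma dft_unitary : dft^t* *m dft = 1%:M.
Proof.
apply/matrixP => a b; rewrite !mxE.
pose z : C := dft_root ^+ b / dft_root ^+ a.
have -> : \sum_j dft^t* a j * dft j b = p.+1%:R^-1 * \sum_(j < p.+1) z ^+ j.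
  rewrite mulr_sumr; apply: eq_bigr => j _.
  by rewrite conj_dftE mxE mulrACA dft_normE mulnC exprM -exprMn /z [dft_root ^+ b / _]mulrC.
have [ab|ab] := eqVneq a b.
  rewrite /z ab divrr ?unitrX// (eq_bigr (fun=> 1)) => [|j _]; last by rewrite expr1n.
  by rewrite sumr_const card_ord mulVf// pnatr_eq0.
have z1 : z != 1.
  rewrite -subr_eq0 -(mulIr_eq0 _ (@mulIr _ (dft_root ^+ a) _)) ?unitrX//.
  rewrite mulrBl mul1r divrK ?unitrX// subr_eq0.
  rewrite (eq_prim_root_expr dft_root_prim) !modn_small//.
  by apply: contraNneq ab => /val_inj ->.
have /eqP : (z - 1) * \sum_(j < p.+1) z ^+ j = 0.
  rewrite -subrX1 /z expr_div_n -!exprM ![(_ * p.+1)%N]mulnC !exprM.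
  by rewrite (prim_expr_order dft_root_prim) !expr1n divr1 subrr.
by rewrite mulf_eq0 subr_eq0 (negPf z1) /= => /eqP ->; rewrite mulr0.
Qed.

Let dft_diagE (d : 'rV[C]_p.+1) i j : (dft *m diag_mx d *m dft^t*) i j =
  \sum_(l < p.+1) p.+1%:R^-1 * d 0 l * (dft_root ^+ i / dft_root ^+ j) ^+ l.
Proof.
rewrite mxE; apply: eq_bigr => l _.
rewrite mul_mx_diag mxE mxE -dft_normE !mxE rmorphM rmorphXn /= conj_dft_root.
rewrite [X in _ * (X * _)]conj_Creal; last first.
  by rewrite realV realE sqrtC_ge0 ler0n.
rewrite exprMn !exprVn -!exprM; ring.
Qed.

Let dft_rootB (i j : 'I_p.+1) :
  dft_root ^+ (i - j)%R = dft_root ^+ i / dft_root ^+ j.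
Proof.
apply: (canRL (mulrK _)); first by rewrite unitrX.
rewrite -exprD -(prim_expr_mod dft_root_prim).
by congr (_ ^+ _); exact: (congr1 val (subrK j i)).
Qed.

Lemma circ_tsqrt (v : tensor C 1 1 p.+1) (d : 'rV[C]_p.+1) :
  circ v = dft *m diag_mx d *m dft^t* ->
  circ (tsqrt v) = dft *m diag_mx (map_mx sqrtC d) *m dft^t*.
Proof.
move=> vE; have DE : dft^t* *m circ v *m dft = diag_mx d.
  by rewrite vE -!mulmxA dft_unitary mulmx1 mulmxA dft_unitary mul1mx.
rewrite /tsqrt DE; set e := \row_j _.
have -> : e = map_mx sqrtC d by apply/rowP => j; rewrite !mxE eqxx mulr1n.
apply/matrixP => i j; rewrite mxE ffunE mxE mxE !dft_diagE.
by apply: eq_bigr => l _; rewrite dft_rootB expr0 divr1.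
Qed.

End SpectralRadius.

(* Main.v *)
Require Import Defs.
From mathcomp Require Import all_boot all_order all_algebra complex.
From mathcomp Require Import all_classical all_reals all_analysis.
From mathcomp Require Import ring.

(** The discrete Fourier transform along the tubes turns the T-product into
    [p.+1] independent matrix products: writing [tdft z A l] for the [l]-th mode
    of [A], one has [tdft z (tprod A B) l = tdft z A l *m tdft z B l]
    ([tdft_tprod]), and [tdft z] is a bijection ([tdftK], [itdftK]).  All the
    notions involved are read mode by mode:
    - a tensor is non-singular iff each of its modes is invertible
      ([tnonsingular_tdft]);
    - a tubular tensor is positive semidefinite iff its modes are nonnegative
      ([tpsd_tdft]), and the modes of a positive definite one are positive
      ([tpd_tdft]);
    - a tubular tensor is a tubular eigenvalue of [A] iff its [l]-th mode is an
      eigenvalue of the [l]-th mode of [A], for all [l]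
      ([tubular_eigenvalue_tdft]).

    Since eigenvalues can be chosen independently in the modes, a dominant
    tubular eigenvalue is obtained by taking in each mode an eigenvalue of
    maximal modulus, and the modes of the tubular spectral radius bound the
    moduli of the eigenvalues of the modes of [A]
    ([tubular_spectral_radius_ub]).  The hypothesis thus says that all the
    eigenvalues of all the modes have modulus less than 1, and the result follows
    from the Neumann series for matrices ([neumann_series]).

    The latter needs [A ^+ k --> 0] when the eigenvalues [a_i] of [A] have modulus
    less than 1 ([cvg0_power]).  No normal form is used: by Cayley-Hamilton the
    product of the [A - a_i] vanishes, and its factors are removed one at a time,
    because [u k.+1 = a * u k + v k] with [`|a| < 1] and [v --> 0] forces [u --> 0]
    ([cvg0_affine_rec]). *)

Import Order.TTheory GRing.Theory Num.Theory numFieldNormedType.Exports.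
Local Open Scope ring_scope.

Set Implicit Arguments.
Unset Strict Implicit.
Unset Printing Implicit Defensive.

(** * The Fourier transform along the tubes *)

Lemma tprodE (T : pzRingType) p n m l (X : tensor T n m p.+1)
    (Y : tensor T m l p.+1) (k : 'I_p.+1) :
  tprod X Y k = \sum_j X (k - j) *m Y j.
Proof.
by rewrite /tprod /tfold ffunE /bcirc /tunfold mul_mxblock_mxrow mxcolK.
Qed.

Lemma char_poly_tr (K : comNzRingType) n (M : 'M[K]_n) : char_poly M^T = char_poly M.
Proof.
rewrite /char_poly -[in RHS]det_tr; congr (\det _).
by rewrite /char_poly_mx linearB /= tr_scalar_mx map_trmx.
Qed.

(** Eigenvalues are roots of the characteristic polynomial, here with column
    eigenvectors. *)
Lemma root_char_polyP (K : fieldType) n (M : 'M[K]_n) a :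
  reflect (exists2 x : 'cV[K]_n, M *m x = a *: x & x != 0)
    (root (char_poly M) a).
Proof.
rewrite -char_poly_tr -eigenvalue_root_char.
apply: (iffP eigenvalueP) => -[x xE x0]; exists x^T.
- by apply: trmx_inj; rewrite trmx_mul trmxK xE linearZ /= trmxK.
- by rewrite -(inj_eq (@trmx_inj _ _ _)) trmxK trmx0.
- by rewrite -trmx_mul xE linearZ.
- by rewrite -(inj_eq (@trmx_inj _ _ _)) trmxK trmx0.
Qed.

Section Fourier.
Local Open Scope sesquilinear_scope.
Variables (C : numClosedFieldType) (p : nat) (z : C).
Hypothesis z_prim : p.+1.-primitive_root z.

(** The [l]-th Fourier mode of [X], for a primitive [p.+1]-th root of unity [z]. *)
Definition tdft n m (X : tensor C n m p.+1) (l : 'I_p.+1) : 'M[C]_(n, m) :=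
  \sum_(k < p.+1) z ^+ (l * k) *: X k.

(** The tensor whose Fourier modes are the matrices [M l]. *)
Definition itdft n m (M : 'I_p.+1 -> 'M[C]_(n, m)) : tensor C n m p.+1 :=
  [ffun k : 'I_p.+1 => \sum_(l < p.+1) (p.+1%:R^-1 * z ^- (l * k)) *: M l].

Let z_neq0 : z != 0.
Proof. by rewrite (prim_root_eq0 z_prim). Qed.

Let zX_neq0 i : z ^+ i != 0.
Proof. by rewrite expf_neq0. Qed.

(** The sum [i + j] is the one of ['I_p.+1], modulo [p.+1]; the equation holds
    because [z ^+ p.+1 = 1]. *)
Lemma root_mulD (l i j : 'I_p.+1) :
  z ^+ (l * (i + j)%R) = z ^+ (l * i) * z ^+ (l * j).
Proof.
rewrite -exprD -mulnDr !exprM /= expr_mod// -exprM mulnC exprM.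
by rewrite (prim_expr_order z_prim) expr1n.
Qed.

Lemma root_mulN (l i : 'I_p.+1) : z ^+ (l * (- i)%R) = z ^- (l * i).
Proof.
apply: (mulIf (zX_neq0 (l * i))); rewrite -root_mulD addNr muln0 expr0.
by rewrite mulVf.
Qed.

Lemma conj_root i : (z ^+ i)^* = z ^- i.
Proof.
suff zz : z * z^* = 1.
  rewrite rmorphXn /=; apply: (mulfI (zX_neq0 i)).
  by rewrite -exprMn zz expr1n divff.
rewrite -normCK; suff -> : `|z| = 1 by rewrite expr1n.
apply: (pexpIrn (ltn0Sn p)); rewrite ?nnegrE ?ler01//.
by rewrite -normrX (prim_expr_order z_prim) normr1 expr1n.
Qed.

(** Orthogonality of the characters of the integers modulo [p.+1]. *)
Lemma sum_root (a b : 'I_p.+1) :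
  \sum_(l < p.+1) z ^+ (l * a) * z ^- (l * b) = (p.+1 * (a == b))%:R.
Proof.
have [->|ab] := eqVneq a b.
  rewrite (eq_bigr (fun=> 1)) ?sumr_const ?card_ord ?muln1// => l _.
  by rewrite divff.
pose y := z ^+ a / z ^+ b.
have y1 : y != 1.
  apply: contra ab => /eqP y1; apply/eqP/val_inj/eqP.
  have : z ^+ a == z ^+ b by rewrite -[z ^+ b]mul1r -y1 divfK.
  by rewrite (eq_prim_root_expr z_prim) !modn_small.
have /eqP : (y - 1) * \sum_(l < p.+1) y ^+ l = 0.
  rewrite -subrX1 /y expr_div_n -!exprM ![(_ * p.+1)%N]mulnC !exprM.
  by rewrite (prim_expr_order z_prim) !expr1n divr1 subrr.
rewrite mulf_eq0 subr_eq0 (negPf y1) /= muln0 => /eqP y_sum.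
rewrite -[RHS]/0 -[RHS]y_sum.
by apply: eq_bigr => l _; rewrite /y expr_div_n -!exprM ![(l * _)%N]mulnC.
Qed.

Let p_neq0 : p.+1%:R != 0 :> C.
Proof. by rewrite pnatr_eq0. Qed.

Lemma tdftK n m (X : tensor C n m p.+1) : itdft (tdft X) = X.
Proof.
apply/ffunP => k; rewrite ffunE.
transitivity (\sum_(j < p.+1) (p.+1%:R^-1 *
    \sum_(l < p.+1) z ^+ (l * j) * z ^- (l * k)) *: X j).
  under eq_bigr => l _ do rewrite scaler_sumr.
  rewrite exchange_big; apply: eq_bigr => j _.
  rewrite mulr_sumr scaler_suml; apply: eq_bigr => l _.
  by rewrite scalerA mulrAC mulrA.
rewrite (bigD1 k)//= [X in _ + X]big1 => [|j /negPf jk].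
  by rewrite sum_root eqxx muln1 mulVf// scale1r addr0.
by rewrite sum_root jk muln0 mulr0 scale0r.
Qed.

Lemma itdftK n m (M : 'I_p.+1 -> 'M[C]_(n, m)) l : tdft (itdft M) l = M l.
Proof.
rewrite /tdft.
transitivity (\sum_(j < p.+1) (p.+1%:R^-1 *
    \sum_(k < p.+1) z ^+ (k * l) * z ^- (k * j)) *: M j).
  under eq_bigr => k _ do rewrite ffunE scaler_sumr.
  rewrite exchange_big; apply: eq_bigr => j _.
  rewrite mulr_sumr scaler_suml; apply: eq_bigr => k _.
  by rewrite scalerA mulrCA [(l * k)%N]mulnC [(j * k)%N]mulnC.
rewrite (bigD1 l)//= [X in _ + X]big1 => [|j]; rewrite sum_root.
  by rewrite eqxx muln1 mulVf// scale1r addr0.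
by rewrite eq_sym => /negPf ->; rewrite muln0 mulr0 scale0r.
Qed.

Lemma tdft_inj n m (X Y : tensor C n m p.+1) : tdft X =1 tdft Y -> X = Y.
Proof.
move=> XY; rewrite -(tdftK X) -(tdftK Y); apply/ffunP => k.
by rewrite !ffunE; apply: eq_bigr => l _; rewrite XY.
Qed.

Lemma tdft_tprod n m q (X : tensor C n m p.+1) (Y : tensor C m q p.+1) l :
  tdft (tprod X Y) l = tdft X l *m tdft Y l.
Proof.
rewrite /tdft mulmx_sumr.
under eq_bigr => k _ do rewrite tprodE scaler_sumr.
rewrite exchange_big; apply: eq_bigr => j _.
rewrite (reindex_inj (addIr j)) /= mulmx_suml; apply: eq_bigr => k _.
by rewrite addrK root_mulD -scalemxAl -scalemxAr scalerA.
Qed.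

Lemma tdftB n m (X Y : tensor C n m p.+1) l :
  tdft (X - Y) l = tdft X l - tdft Y l.
Proof. by rewrite -sumrB; apply: eq_bigr => k _; rewrite !ffunE scalerBr. Qed.

Lemma tdft_sum n m (I : Type) (r : seq I) (X : I -> tensor C n m p.+1) l :
  tdft (\sum_(i <- r) X i) l = \sum_(i <- r) tdft (X i) l.
Proof.
rewrite exchange_big /=; apply: eq_bigr => k _.
by rewrite sum_ffunE scaler_sumr.
Qed.

Lemma tdft_tid n l : tdft (tid : tensor C n n p.+1) l = 1%:M.
Proof.
rewrite /tdft (bigD1 0)//= big1 => [|k /negPf k0].
  by rewrite ffunE eqxx muln0 expr0 scale1r addr0.
by rewrite ffunE k0 scaler0.
Qed.

Lemma tdft_tpow n (A : tensor C n.+1 n.+1 p.+1) k l :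
  tdft (tpow A k) l = tdft A l ^+ k.
Proof.
by elim: k => [|k IH]; rewrite ?tdft_tid// exprS -IH tdft_tprod.
Qed.

Lemma tdft_tconj n m (X : tensor C n m p.+1) l :
  tdft (tconj X) l = (tdft X l)^t*.
Proof.
apply/matrixP => i j; rewrite !mxE !summxE rmorph_sum (reindex_inj oppr_inj).
apply: eq_bigr => k _; rewrite /= !mxE ffunE opprK !mxE root_mulN.
by rewrite rmorphM /= conj_root.
Qed.

Lemma is_tinverse_tdft n (A B : tensor C n n p.+1) :
  is_tinverse A B <-> forall l, tdft A l *m tdft B l = 1%:M.
Proof.
split=> [[AB _] l|AB]; first by rewrite -tdft_tprod AB tdft_tid.
split; apply: tdft_inj => l; rewrite tdft_tprod tdft_tid//.
exact: mulmx1C.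
Qed.

Lemma tnonsingular_tdft n (A : tensor C n n p.+1) :
  tnonsingular A <-> forall l, tdft A l \in unitmx.
Proof.
split=> [[B /is_tinverse_tdft AB] l|A_unit].
  by have [] := mulmx1_unit (AB l).
exists (itdft (fun l => invmx (tdft A l))); apply/is_tinverse_tdft => l.
by rewrite itdftK mulmxV.
Qed.

Lemma tdft_tinv n (A : tensor C n n p.+1) l :
  tnonsingular A -> tdft (tinv A) l = invmx (tdft A l).
Proof.
move=> A_ns; have A_unit := (tnonsingular_tdft A).1 A_ns l.
have /is_tinverse_tdft/(_ l) AB : is_tinverse A (tinv A).
  exact: (xgetPex 0 A_ns).
by apply: (can_inj (mulKmx A_unit)); rewrite AB mulmxV.
Qed.

(** Parseval's identity for the quadratic form of the positivity order. *)
Lemma tform_tdft n (A : tensor C n n p.+1) (X : tensor C n 1 p.+1) :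
  tprod (tprod (tconj X) A) X 0 0 0 = p.+1%:R^-1 *
  \sum_l ((tdft X l)^t* *m tdft A l *m tdft X l) 0 0.
Proof.
rewrite -{1}(tdftK (tprod _ X)) ffunE summxE mulr_sumr.
apply: eq_bigr => l _.
by rewrite mxE muln0 expr0 invr1 mulr1 !tdft_tprod tdft_tconj.
Qed.

Let mx11_form (a x : 'M[C]_1) :
  (x^t* *m a *m x) 0 0 = a 0 0 * `|x 0 0| ^+ 2.
Proof.
rewrite !mxE big_ord1 !mxE big_ord1 !mxE normCK.
by rewrite mulrAC [RHS]mulrC [x 0 0 * _]mulrC.
Qed.

(** Placing 1 at mode [l] and 0 elsewhere isolates one mode of a tube in its
    quadratic form. *)
Let mode (l j : 'I_p.+1) : 'M[C]_1 := (j == l)%:R%:M.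

Let tform_mode (v : tensor C 1 1 p.+1) l :
  tprod (tprod (tconj (itdft (mode l))) v) (itdft (mode l)) 0 0 0 =
  p.+1%:R^-1 * tdft v l 0 0.
Proof.
rewrite tform_tdft (bigD1 l)//= big1 => [|j /negPf jl].
  by rewrite addr0 mx11_form itdftK mxE !eqxx normr1 expr1n mulr1.
by rewrite mx11_form itdftK mxE jl mul0rn normr0 expr0n mulr0.
Qed.

Let mode_neq0 l : itdft (mode l) != 0.
Proof.
apply/eqP => /(congr1 (fun X => tdft X l 0 0)); rewrite itdftK mxE !eqxx.
rewrite /tdft summxE big1 => [/eqP|k _]; first by rewrite oner_eq0.
by rewrite ffunE scaler0 mxE.
Qed.

Let p_gt0 : 0 < p.+1%:R^-1 :> C.
Proof. by rewrite invr_gt0 ltr0n. Qed.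

Lemma tpd_tdft (v : tensor C 1 1 p.+1) l : tpd v -> 0 < tdft v l 0 0.
Proof. by move=> /(_ _ (mode_neq0 l)); rewrite tform_mode pmulr_rgt0. Qed.

Lemma tpsd_tdft (v : tensor C 1 1 p.+1) :
  tpsd v <-> forall l, 0 <= tdft v l 0 0.
Proof.
split=> [+ l|v_ge0 X _].
  by move=> /(_ _ (mode_neq0 l)); rewrite tform_mode pmulr_rge0.
rewrite tform_tdft mulr_ge0 ?(ltW p_gt0)// sumr_ge0// => l _.
by rewrite mx11_form mulr_ge0// exprn_ge0.
Qed.

(** The order on the tubes [u^H * u] compares moduli mode by mode. *)
Lemma tle_modulus (u v : tensor C 1 1 p.+1) :
  tle (tprod (tconj u) u) (tprod (tconj v) v) <->
  forall l, `|tdft u l 0 0| <= `|tdft v l 0 0|.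
Proof.
have E l : tdft (tprod (tconj v) v - tprod (tconj u) u) l 0 0 =
    `|tdft v l 0 0| ^+ 2 - `|tdft u l 0 0| ^+ 2.
  rewrite tdftB !tdft_tprod !tdft_tconj !mxE !big_ord1 !mxE.
  by rewrite !normCK [in LHS]mulrC [X in _ - X]mulrC.
by split=> [/tpsd_tdft le_uv l|le_uv]; [|apply/tpsd_tdft => l];
  move: (le_uv l); rewrite E subr_ge0 ler_sqr ?nnegrE.
Qed.

Let mx11_unit (a : 'M[C]_1) : (a \in unitmx) = (a 0 0 != 0).
Proof. by rewrite unitmxE det_mx11 unitfE. Qed.

Let gram_eq0 n (x : 'cV[C]_n) : ((x^t* *m x) 0 0 == 0) = (x == 0).
Proof.
rewrite mxE; under eq_bigr => i _ do rewrite !mxE mulrC -normCK.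
rewrite psumr_eq0 => [|i _]; last exact: exprn_ge0.
apply/allP/eqP => [x0|-> i _]; last by rewrite mxE normr0 expr0n eqxx.
apply/colP => i; apply/eqP; rewrite mxE -normr_eq0.
by have := x0 i (mem_index_enum i); rewrite /= expf_eq0.
Qed.

Lemma tubular_eigenvalue_tdft n (A : tensor C n n p.+1) (v : tensor C 1 1 p.+1) :
  tubular_eigenvalue A v <->
  forall l, root (char_poly (tdft A l)) (tdft v l 0 0).
Proof.
have scaleE (x : 'cV[C]_n) (a : 'M[C]_1) : x *m a = a 0 0 *: x.
  by rewrite [in LHS](mx11_scalar a) mul_mx_scalar.
split=> [[X [AX /tnonsingular_tdft X_ns]] l|v_root].
  apply/root_char_polyP; exists (tdft X l).
    by rewrite -tdft_tprod AX tdft_tprod scaleE.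
  by have := X_ns l; rewrite tdft_tprod tdft_tconj mx11_unit gram_eq0.
(* The eigenvectors of the modes are the modes of a tubular eigenvector. *)
pose x l := s2val (cid2 (root_char_polyP _ _ (v_root l))).
have xP l : tdft A l *m x l = tdft v l 0 0 *: x l by rewrite /x; case: cid2.
have x0 l : x l != 0 by rewrite /x; case: cid2.
exists (itdft x); split.
  by apply: tdft_inj => l; rewrite !tdft_tprod itdftK xP scaleE.
apply/tnonsingular_tdft => l.
by rewrite tdft_tprod tdft_tconj itdftK mx11_unit gram_eq0.
Qed.

End Fourier.

(** * The Neumann series of a matrix *)

Section Neumann.
Local Open Scope classical_set_scope.

Lemma cvg_sum (K : numFieldType) (I : Type) (r : seq I) (u : I -> nat -> K)
    (a : I -> K) :
  (forall i, u i N @[N --> \oo] --> a i) ->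
  \sum_(i <- r) u i N @[N --> \oo] --> \sum_(i <- r) a i.
Proof.
move=> u_cvg; elim: r => [|i r IH].
  rewrite big_nil; under eq_fun do rewrite big_nil.
  exact: cvg_cst.
rewrite big_cons; under eq_fun do rewrite big_cons.
exact: cvgD.
Qed.

(** The powers of any element of modulus less than 1 become arbitrarily small:
    the archimedean property that geometric convergence requires. *)
Definition null_powers (K : numFieldType) : Prop :=
  forall a e : K, `|a| < 1 -> 0 < e -> exists m : nat, `|a| ^+ m < e.

Lemma complex_null_powers (R : realType) : null_powers R[i].
Proof.
move=> a e a1 e0.
have [r aE] : exists r : R, `|a| = (r%:C)%C by exists (ComplexField.Normc.normc a).
have r0 : 0 <= r by rewrite -ler0c -aE.
have [q q0 eE] : exists2 q : R, 0 < q & e = (q%:C)%C.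
  move: e0; case: e => q i; rewrite ltcE /= => /andP[/eqP -> q0].
  by exists q.
have r1 : `|r| < 1 by rewrite ger0_norm// -ltcR -aE.
have /cvgrPdist_lt /(_ _ q0) [m _ /(_ m (leqnn m)) /=] := cvg_expr r1.
rewrite sub0r normrN ger0_norm ?exprn_ge0// => rm; exists m.
by rewrite aE eE -rmorphXn /= ltcR.
Qed.

Lemma cvg0_affine_rec (K : numFieldType) (a : K) (u v : nat -> K) :
  null_powers K -> `|a| < 1 -> (forall k, u k.+1 = a * u k + v k) ->
  v k @[k --> \oo] --> 0 -> u k @[k --> \oo] --> 0.
Proof.
move=> K_null a1 uS v0; apply/cvgrPdist_le => e e0.
(* Once [v] is below [d], one step maps the bound [e / 2 + r] on [`|u|] to
   [`|a| * (e / 2 + r) + d = e / 2 + `|a| * r]. *)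
have d0 : 0 < e / 2 * (1 - `|a|) by rewrite mulr_gt0 ?divr_gt0 ?subr_gt0.
have [N _ vN] := (cvgrPdist_le _ _).1 v0 _ d0.
have bound m : `|u (m + N)%N| <= e / 2 + `|a| ^+ m * `|u N|.
  elim: m => [|m IH]; first by rewrite expr0 mul1r lerDr ltW ?divr_gt0.
  rewrite addSn uS (le_trans (ler_normD _ _))// normrM exprS.
  have := vN (m + N)%N (leq_addl _ _); rewrite /= sub0r normrN => vm.
  apply: le_trans (lerD (ler_wpM2l (normr_ge0 a) IH) vm) _.
  by rewrite le_eqVlt; apply/orP; left; apply/eqP; ring.
(* The [+ 1] avoids a zero denominator when [u N = 0]. *)
have e1 : 0 < e / 2 / (`|u N| + 1) by rewrite !divr_gt0 ?ltr_wpDl.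
have [M aM] := K_null _ _ a1 e1.
exists (M + N)%N => // k /= MNk; rewrite sub0r normrN.
have Nk : (N <= k)%N by rewrite (leq_trans (leq_addl _ _) MNk).
rewrite -(subnK Nk) (le_trans (bound _))// [leRHS]splitr lerD2l.
have aX : `|a| ^+ (k - N) <= `|a| ^+ M.
  by apply: ler_wiXn2l; rewrite ?normr_ge0 ?(ltW a1)// leq_subRL// addnC.
apply: le_trans (ler_wpM2r (normr_ge0 _) (le_trans aX (ltW aM))) _.
rewrite -[leLHS]mulrA -[leRHS]mulr1 ler_wpM2l ?divr_ge0 ?(ltW e0)//.
by rewrite mulrC ler_pdivrMr ?ltr_wpDl// mul1r lerDl ler01.
Qed.

(** The factors [A - a] are removed one at a time: the entries of [B * A ^+ k]
    satisfy an affine recurrence whose perturbation is the corresponding entry of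
    [B * (A - a) * A ^+ k]. *)
Lemma cvg0_mulmx_power (K : numFieldType) n (A : 'M[K]_n.+1) (s : seq K)
    (B : 'M[K]_n.+1) :
  null_powers K ->
  (forall a, a \in s -> `|a| < 1) ->
  B * horner_mx A (\prod_(a <- s) ('X - a%:P)) = 0 ->
  forall i j, (B * A ^+ k) i j @[k --> \oo] --> 0.
Proof.
move=> K_null; elim: s B => [|a s IH] B s1.
  rewrite big_nil rmorph1 mulr1 => -> i j.
  under eq_fun do rewrite mul0r mxE.
  exact: cvg_cst.
rewrite big_cons rmorphM /= mulrA rmorphB /= horner_mx_X horner_mx_C => B0 i j.
have s1' b : b \in s -> `|b| < 1 by move=> bs; rewrite s1// inE bs orbT.
apply: (cvg0_affine_rec (a := a)) K_null _ _ (IH _ s1' B0 i j).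
  by rewrite s1 ?inE ?eqxx.
move=> k; rewrite exprS mulrBr mulrBl -!mulrA.
rewrite -!mulmxE mul_scalar_mx -scalemxAr.
by move: (B *m (A *m _)) (B *m A ^+ k) => X Y; rewrite !mxE [RHS]addrC subrK.
Qed.

Lemma cvg0_power (C : numClosedFieldType) n (A : 'M[C]_n.+1) :
  null_powers C ->
  (forall a, root (char_poly A) a -> `|a| < 1) ->
  forall i j, (A ^+ k) i j @[k --> \oo] --> 0.
Proof.
move=> C_null A1 i j; have [s sE] := closed_field_poly_normal (char_poly A).
rewrite (monicP (char_poly_monic A)) scale1r in sE.
under eq_fun do rewrite -[A ^+ _]mul1r.
apply: (@cvg0_mulmx_power _ _ _ s _ C_null) => [a sa|].
  by apply: A1; rewrite sE root_prod_XsubC.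
by rewrite -sE Cayley_Hamilton mulr0.
Qed.

Lemma max_modulus (C : numClosedFieldType) (s : seq C) :
  s != [::] -> exists2 a, a \in s & forall b, b \in s -> `|b| <= `|a|.
Proof.
elim: s => [//|x [|y s] IH] _.
  by exists x => [|b]; rewrite inE// => /eqP ->.
have [a as_ aP] := IH isT.
have [ax|xa] := real_leP (normr_real a) (normr_real x).
  exists x => [|b]; first by rewrite inE eqxx.
  by rewrite inE => /predU1P[-> //|/aP ba]; exact: le_trans ba ax.
exists a => [|b]; first by rewrite inE as_ orbT.
by rewrite inE => /predU1P[->|/aP //]; exact: ltW.
Qed.

Lemma spectral_radius_attained (C : numClosedFieldType) n (A : 'M[C]_n) :
  (0 < n)%N -> exists2 a, root (char_poly A) a &
    forall b, root (char_poly A) b -> `|b| <= `|a|.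
Proof.
move=> n0; have [s sE] := closed_field_poly_normal (char_poly A).
rewrite (monicP (char_poly_monic A)) scale1r in sE.
have s0 : s != [::].
  apply: contraTneq n0 => s0; have := size_char_poly A.
  by rewrite sE s0 big_nil size_poly1 => -[<-].
have [a sa aP] := max_modulus s0; exists a.
  by rewrite sE root_prod_XsubC.
by move=> b; rewrite sE root_prod_XsubC; exact: aP.
Qed.

Lemma unitmx_sub1 (C : numClosedFieldType) n (A : 'M[C]_n.+1) :
  (forall a, root (char_poly A) a -> `|a| < 1) -> 1%:M - A \in unitmx.
Proof.
move=> A1; have -> : (1%:M - A \in unitmx) = (A - 1%:M \in unitmx).
  by rewrite -opprB; exact: unitrN.
apply/negPn/negP => A_sing.
have : root (char_poly A) 1.
  by rewrite -eigenvalue_root_char /eigenvalue kermx_eq0 row_free_unit.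
by move/A1; rewrite normr1 ltxx.
Qed.

(** The partial sums are [(1 - A)^-1 * (1 - A ^+ N)], and [A ^+ N] tends to 0. *)
Lemma neumann_series (C : numClosedFieldType) n (A : 'M[C]_n.+1) i j :
  null_powers C -> (forall a, root (char_poly A) a -> `|a| < 1) ->
  (\sum_(0 <= k < N) A ^+ k) i j @[N --> \oo] --> invmx (1%:M - A) i j.
Proof.
move=> C_null A1; have A_unit := unitmx_sub1 A1.
have sumE N : \sum_(0 <= k < N) A ^+ k = invmx (1%:M - A) *m (1%:M - A ^+ N).
  have -> : 1%:M - A ^+ N = (1%:M - A) *m \sum_(k < N) A ^+ k.
    by have /(congr1 -%R) := subrX1 A N; rewrite -mulNr !opprB.
  by rewrite mulKmx// big_mkord.
rewrite -[invmx _]mulmx1 mxE; under eq_fun do rewrite sumE mxE.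
apply: cvg_sum => a; apply: cvgM; first exact: cvg_cst.
rewrite -[1%:M a j]subr0; under eq_fun do rewrite mxE [X in _ + X]mxE.
apply: cvgB; first exact: cvg_cst.
exact: cvg0_power.
Qed.

End Neumann.

(** * Fourier modes of the tubular spectral radius *)

Section SpectralRadiusModes.
Local Open Scope sesquilinear_scope.
Variables (R : realType) (p : nat).
Local Notation C := R[i].
Local Notation w := (dft_root R p).
Local Notation z := (dft_root R p)^-1.
Local Notation F := (dft R p).

Lemma dft_rootV_prim : p.+1.-primitive_root z.
Proof.
have wP := dft_root_prim R p; have w_neq0 := prim_root_eq0 wP.
suff -> : w^-1 = w ^+ p by rewrite (prim_root_exp_coprime _ wP) coprimenS.
apply: (mulfI (negbT w_neq0)).
by rewrite -exprS (prim_expr_order wP) divff// w_neq0.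
Qed.

Let zP := dft_rootV_prim.

(** The columns of the DFT matrix are eigenvectors of circulant matrices; with the
    convention [w = exp (- 2 pi i / p.+1)] for the DFT matrix, the eigenvalues are
    the modes for the inverse root [w^-1]. *)
Lemma circ_dft (v : tensor C 1 1 p.+1) :
  circ v = F *m diag_mx (\row_l tdft z v l 0 0) *m F^t*.
Proof.
suff -> : F *m diag_mx (\row_l tdft z v l 0 0) = circ v *m F.
  by rewrite -mulmxA (mulmx1C (dft_unitary R p)) mulmx1.
apply/matrixP => i l; rewrite mul_mx_diag !mxE summxE mulr_sumr.
have subi_inj : injective (fun k : 'I_p.+1 => i - k).
  by move=> a b /addrI/oppr_inj.
rewrite [RHS](reindex_inj subi_inj); apply: eq_bigr => k _ /=.
rewrite !mxE opprB addrC subrK.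
rewrite ![(_ * nat_of_ord l)%N]mulnC root_mulD ?dft_root_prim//.
rewrite root_mulN ?dft_root_prim// exprVn.
ring.
Qed.

Lemma tdft_tsqrt (v : tensor C 1 1 p.+1) l :
  tdft z (tsqrt v) l 0 0 = sqrtC (tdft z v l 0 0).
Proof.
have := circ_tsqrt (circ_dft v); rewrite circ_dft.
move/(congr1 (fun M => (F^t* *m M *m F) l l)).
rewrite -!mulmxA dft_unitary !mulmx1 !mulmxA dft_unitary !mul1mx.
by rewrite !mxE !eqxx !mulr1n.
Qed.

(** Each mode of the tubular spectral radius bounds the moduli of the eigenvalues
    of the corresponding mode of [A]. The hypothesis [0 < n] gives the modes of [A]
    an eigenvalue, so that a dominant tubular eigenvalue exists. *)
Lemma tubular_spectral_radius_ub n (A : tensor C n n p.+1) l b : (0 < n)%N ->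
  root (char_poly (tdft z A l)) b ->
  `|b| <= tdft z (tubular_spectral_radius A) l 0 0.
Proof.
move=> n0 Ab; rewrite /tubular_spectral_radius; set mu := xget 0 _.
pose m k := s2val (cid2 (spectral_radius_attained (tdft z A k) n0)).
have m_root k : root (char_poly (tdft z A k)) (m k) by rewrite /m; case: cid2.
have m_max k c : root (char_poly (tdft z A k)) c -> `|c| <= `|m k|.
  by rewrite /m; case: cid2 => x _ /= xP; exact: xP.
(* [nu] is a dominant tubular eigenvalue, so the one selected by [xget] is
   dominant too. *)
pose nu := itdft z (fun k => (m k)%:M : 'M[C]_1).
have nuE k : tdft z nu k 0 0 = m k by rewrite itdftK// mxE.
have nu_eig : tubular_eigenvalue A nu.
  by apply/(tubular_eigenvalue_tdft zP) => k; rewrite nuE.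
have [mu_eig mu_max] : [set mu | tubular_eigenvalue A mu /\
    forall l, tubular_eigenvalue A l ->
      tle (tprod (tconj l) l) (tprod (tconj mu) mu)]%classic mu.
  apply: xgetPex; exists nu; split=> // lam /(tubular_eigenvalue_tdft zP) lamP.
  by apply/(tle_modulus zP) => k; rewrite nuE; exact: m_max.
rewrite tdft_tsqrt tdft_tprod// tdft_tconj// !mxE big_ord1 !mxE mulrC -normCK.
rewrite sqrCK ?normr_ge0// (le_trans (m_max _ _ Ab))// -nuE.
exact: ((tle_modulus zP _ _).1 (mu_max _ nu_eig)).
Qed.

End SpectralRadiusModes.

Lemma tube_delta (T : pzRingType) p :
  tube (delta_mx 0 0) = tid :> tensor T 1 1 p.+1.
Proof.
apply/ffunP => k; rewrite !ffunE mxE andbT; apply/matrixP => i j.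
by rewrite !ord1 mxE; case: (k == 0); rewrite !mxE.
Qed.

(** * The Neumann series of a tensor *)

Unset Implicit Arguments.

Theorem proposition3p4 (R : realType) (n p : nat) (hn : (0 < n)%N)
    (A : tensor R[i] n n p.+1)
    (hA : tlt (tubular_spectral_radius A) (tube (delta_mx 0 0))) :
  tnonsingular (tid - A) /\
  tensor_cvg (fun N => \sum_(0 <= k < N) tpow A k) (tinv (tid - A)).
Proof.
have zP := dft_rootV_prim R p; set z := _^-1 in zP.
have A1 l a : root (char_poly (tdft z A l)) a -> `|a| < 1.
  move=> /(tubular_spectral_radius_ub hn) /le_lt_trans; apply.
  have := tpd_tdft zP l hA; rewrite tdftB mxE [X in _ + X]mxE subr_gt0.
  by rewrite tube_delta tdft_tid mxE.
case: n hn A {hA} A1 => [//|n] _ A A1.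
have IA_ns : tnonsingular (tid - A).
  apply/(tnonsingular_tdft zP) => l; rewrite tdftB tdft_tid.
  exact/unitmx_sub1/A1.
(* Each entry is a fixed linear combination of the entries of the modes. *)
split=> // k i j; rewrite -(tdftK zP (tinv _)) ffunE summxE.
under eq_fun do rewrite -(tdftK zP (\sum_(0 <= k < _) _)) ffunE summxE.
apply: cvg_sum => l; rewrite mxE tdft_tinv// tdftB tdft_tid.
under eq_fun do rewrite mxE tdft_sum.
apply: cvgM; first exact: cvg_cst.
under eq_fun do under eq_bigr do rewrite tdft_tpow//.
apply: neumann_series (A1 l); exact: complex_null_powers.
Qed.
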